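(* Let $(M,\Omega)$ be a holomorphic symplectic manifold. A real-symplectic form $N\subset M$ is invariant under the Hamiltonian flow generated by a holomorphic function $f=u+iv$ ($u,v$ real-valued) if and only if $v$ is locally constant on $N$. In this case, the flow on $N$ is identical to the Hamiltonian flow generated by the restriction of $u$ to $(N,\widehat\omega_R)$.
   Context: A holomorphic symplectic manifold is a complex manifold $M$ (complex structure $I$) with a closed non-degenerate holomorphic 2-form $\Omega=\omega_R+i\omega_I$, $\omega_R,\omega_I$ real. The Hamiltonian vector field $X_f$ of a holomorphic function $f$ is defined by $\Omega(X_f,Y)=\langle df,Y\rangle$ for all $Y$; on a real symplectic manifold $(N,\omega)$ the Hamiltonian vector field of $h$ is defined by $\omega(X_h,Y)=\langle dh,Y\rangle$. A real-symplectic form of $(M,\Omega)$ is a submanifold $N\subset M$ that is totally real ($T_xN\cap I(T_xN)=\{0\}$ for all $x\in N$), has half the real dimension of $M$, and on which $\Omega$ restricts to a purely real form. Then $\widehat\omega_R=\omega_R|_N$ is a symplectic form on $N$. ''$N$ is invariant under the flow of $X_f$'' means that $X_f$ is tangent to $N$ at every point of $N$. *)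

(* Defs.v *)
From HB Require Import structures.
From mathcomp Require Import all_boot all_order all_algebra.
From mathcomp Require Import complex.
From mathcomp Require Import all_classical all_reals all_analysis.
Set Implicit Arguments.
Unset Strict Implicit.
Unset Printing Implicit Defensive.
Import Order.TTheory GRing.Theory Num.Theory.
Import numFieldNormedType.Exports.
Local Open Scope classical_set_scope.
Local Open Scope ring_scope.
Local Open Scope complex_scope.

(* Manifolds modelled on K^n, for K the real or the complex numbers.  The     *)
(* parameter [reg] is the class of admissible maps on (open) subsets of K^n:  *)
(* C^oo maps for K real, holomorphic maps for K complex.                      *)

Definition regularity (K : numFieldType) (n : nat) :=
  forall W : normedModType K, set 'rV[K]_n -> ('rV[K]_n -> W) -> Prop.

(* [coord] and [param] are total functions; they are meaningful only on       *)
(* [dom] and on [coord @` dom] respectively.                                  *)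
Record chart (K : numFieldType) (n : nat) (T : topologicalType) := Chart {
  dom : set T ;
  coord :> T -> 'rV[K]_n ;
  param : 'rV[K]_n -> T ;
  open_dom : open dom ;
  open_img : open (coord @` dom) ;
  coordK : forall x, dom x -> param (coord x) = x ;
  coord_continuous : forall x, dom x -> {for x, continuous coord} ;
  param_continuous :
    forall z, (coord @` dom) z -> {for z, continuous param} }.

Definition img (K : numFieldType) (n : nat) (T : topologicalType)
  (c : chart K n T) : set 'rV[K]_n := c @` dom c.

(* The atlas is indexed by the points of T, the chart of index x being        *)
(* defined around x.  Any atlas yields such a family by choosing a chart      *)
(* around every point, so this is no restriction.                             *)
Record manifold (K : numFieldType) (n : nat) (reg : regularity K n)
  (T : topologicalType) := Manifold {
  chart_at : T -> chart K n T ;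
  dom_chart_at : forall x, dom (chart_at x) x ;
  transition_regular : forall x y : T,
    reg _ (img (chart_at x) `&` param (chart_at x) @^-1` dom (chart_at y))
          (chart_at y \o param (chart_at x)) ;
  manifold_hausdorff : hausdorff_space T ;
  manifold_second_countable : @second_countable T }.

(* The tangent space at x is identified with K^n through the chart            *)
(* [chart_at x].  Thus a vector field is a function T -> K^n and a field of   *)
(* bilinear forms a function T -> K^n -> K^n -> K.                            *)
Section Calculus.
Context (K : numFieldType) (n : nat) (reg : regularity K n).
Context (T : topologicalType) (S : manifold reg T).
Implicit Types (f : T -> K) (w : T -> 'rV[K]_n -> 'rV[K]_n -> K).

Definition regular_function f : Prop :=
  forall x : T, reg (W := K^o) (img (chart_at S x)) (f \o param (chart_at S x)).

Definition differential f (x : T) : 'rV[K]_n -> K :=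
  'd (f \o param (chart_at S x) : 'rV[K]_n -> K^o) (chart_at S x x).

(* The form w read in the chart of index x, at the point of coordinates z:    *)
(* the tangent vectors are moved from the chart of index x to the chart of    *)
(* index y := param z, in which [w y] is expressed.                           *)
Definition form_in w (x : T) (u v z : 'rV[K]_n) : K^o :=
  let y := param (chart_at S x) z in
  w y ('d (chart_at S y \o param (chart_at S x)) z u)
      ('d (chart_at S y \o param (chart_at S x)) z v).

(* [symplectic_closed] is dw = 0, evaluated on constant vector fields.        *)
Record symplectic w : Prop := Symplectic {
  symplectic_linearl : forall x v, scalar (fun u => w x u v) ;
  symplectic_linearr : forall x u, scalar (w x u) ;
  symplectic_alternating : forall x u, w x u u = 0 ;
  symplectic_regular :
    forall x u v, reg (img (chart_at S x)) (form_in w x u v) ;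
  symplectic_closed : forall (x : T) (z : 'rV[K]_n), img (chart_at S x) z ->
    forall a b c : 'rV[K]_n,
      'D_a (form_in w x b c) z + 'D_b (form_in w x c a) z
      + 'D_c (form_in w x a b) z = 0 ;
  symplectic_nondegenerate :
    forall x u, (forall v, w x u v = 0) -> u = 0 }.

Definition is_hamiltonian_field w f (X : T -> 'rV[K]_n) : Prop :=
  forall (x : T) (Y : 'rV[K]_n), w x (X x) Y = differential f x Y.

End Calculus.

Definition holomorphic_on (R : realType) (n : nat) : regularity R[i] n :=
  fun W A f => forall z, A z -> differentiable f z.

Fixpoint Ck_on (R : realType) (n : nat) (W : normedModType R) (k : nat)
    (A : set 'rV[R]_n) (f : 'rV[R]_n -> W) : Prop :=
  if k is k'.+1 then
    (forall x, A x -> differentiable f x) /\ (forall v, Ck_on k' A ('D_v f))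
  else forall x, A x -> {for x, continuous f}.

Definition smooth_on (R : realType) (n : nat) : regularity R n :=
  fun W A f => forall k, Ck_on k A f.

Notation complex_manifold R n M := (manifold (@holomorphic_on R n) M).
Notation smooth_manifold R n T := (manifold (@smooth_on R n) T).

Definition Re_mx (R : realType) (n : nat) (z : 'rV[R[i]]_n) : 'rV[R]_n :=
  map_mx (@complex.Re R) z.
Definition Im_mx (R : realType) (n : nat) (z : 'rV[R[i]]_n) : 'rV[R]_n :=
  map_mx (@complex.Im R) z.

(* Real differential of a map R^k -> C^n.                                     *)
Definition real_diff (R : realType) (k n : nat) (F : 'rV[R]_k -> 'rV[R[i]]_n)
    (y v : 'rV[R]_k) : 'rV[R[i]]_n :=
  \row_j (('d (@Re_mx R n \o F) y v) 0 j +i* ('d (@Im_mx R n \o F) y v) 0 j).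

(* Below, the subset N of M is viewed as a type carrying the subspace         *)
(* topology, and a structure of smooth manifold SN on it is given.            *)
Section Submanifold.
Context (R : realType) (n k : nat) (M : topologicalType).
Context (CM : complex_manifold R n M) (N : set M) (SN : smooth_manifold R k N).

Definition inclusion_in (x : N) (y : M) : 'rV[R]_k -> 'rV[R[i]]_n :=
  fun z => chart_at CM y (set_val (param (chart_at SN x) z)).

Definition dincl (x : N) : 'rV[R]_k -> 'rV[R[i]]_n :=
  real_diff (inclusion_in x (set_val x)) (chart_at SN x x).

Definition embedded_submanifold : Prop :=
  (forall (x : N) (y : M),
     let A := img (chart_at SN x) `&`
       [set z | dom (chart_at CM y) (set_val (param (chart_at SN x) z))] in
     smooth_on A (@Re_mx R n \o inclusion_in x y) /\
     smooth_on A (@Im_mx R n \o inclusion_in x y)) /\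
  (forall x : N, injective (dincl x)).

Definition tangent_space (x : N) : set 'rV[R[i]]_n := range (dincl x).

Definition totally_real : Prop := forall x : N,
  tangent_space x `&` [set 'i%C *: v | v in tangent_space x] = [set 0].

Definition real_symplectic_form
    (Omega : M -> 'rV[R[i]]_n -> 'rV[R[i]]_n -> R[i]) : Prop :=
  [/\ embedded_submanifold,
      totally_real,
      (2 * k = n.*2)%N (* n.*2 is the real dimension of M *)
    & forall (x : N) (u v : 'rV[R[i]]_n),
        tangent_space x u -> tangent_space x v ->
        complex.Im (Omega (set_val x) u v) = 0].

Definition omegaR_hat (Omega : M -> 'rV[R[i]]_n -> 'rV[R[i]]_n -> R[i])
    (x : N) (u v : 'rV[R]_k) : R :=
  complex.Re (Omega (set_val x) (dincl x u) (dincl x v)).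

Definition invariant_under_flow (X : M -> 'rV[R[i]]_n) : Prop :=
  forall x : N, tangent_space x (X (set_val x)).

(* Integral curves, in real time, in N and in M.                              *)
Definition integral_curve (Z : N -> 'rV[R]_k) (J : set R) (g : R -> N) :=
  forall t : R, J t -> {for t, continuous g} /\
    is_derive t 1 (chart_at SN (g t) \o g) (Z (g t)).

Definition complex_integral_curve (X : M -> 'rV[R[i]]_n) (J : set R)
    (g : R -> M) :=
  forall t : R, J t -> [/\ {for t, continuous g},
    is_derive t 1 (@Re_mx R n \o chart_at CM (g t) \o g) (Re_mx (X (g t))) &
    is_derive t 1 (@Im_mx R n \o chart_at CM (g t) \o g) (Im_mx (X (g t)))].

End Submanifold.

Definition locally_constant (T : topologicalType) (V : Type) (h : T -> V) :=
  forall x : T, \forall y \near x, h y = h x.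

(* Main.v *)
Require Import Defs.
From HB Require Import structures.
From mathcomp Require Import all_boot all_order all_algebra.
From mathcomp Require Import complex ring lra.
From mathcomp Require Import all_classical all_reals all_analysis.
Import Order.TTheory GRing.Theory Num.Theory.
Import numFieldNormedType.Exports.
Local Open Scope classical_set_scope.
Local Open Scope ring_scope.
Local Open Scope complex_scope.

(* At x in N the tangent space T of N is a real form of C^n on which Omega is
   real, so C^n = T + iT and Omega is nondegenerate on T.  Write X_f = a + i b
   with a, b in T.  For w in T the chain rule gives
   d(v|N)(w) = Im Omega(X_f, w) = Omega(b, w), hence v|N is locally constant iff
   b = 0 everywhere, i.e. iff X_f is tangent to N; likewise
   d(u|N)(w) = Re Omega(X_f, w) is then omegaR_hat(X_f, w).  Integral curves in M
   and in N correspond because the inclusion of N has a linear left inverse to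
   first order at each point. *)

(** * Differentials as first-order approximations *)

Section Differentials.
Context {K : numFieldType}.
Implicit Types V W : normedModType K.

Lemma lipschitz_linear_continuous {V W} (f : {linear V -> W}) (c : K) :
  0 < c -> (forall x, `|f x| <= c * `|x|) -> continuous f.
Proof.
move=> c0 fc x; apply/cvgrPdist_lt => e e0; near=> y.
rewrite -linearB (le_lt_trans (fc _))// -ltr_pdivlMl//.
by near: y; apply: cvgr_dist_lt => //; rewrite mulrC divr_gt0.
Unshelve. all: by end_near. Qed.

Lemma rV_linear_continuous {n} {W} (f : {linear 'rV[K]_n -> W}) : continuous f.
Proof.
(* The sum alone bounds [f]; adding 1 keeps the Lipschitz constant positive when [f] is zero. *)
pose c := 1 + \sum_(i < n) `|f (delta_mx 0 i)|.
have c0 : 0 < c by rewrite ltr_pwDl// sumr_ge0.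
apply: (lipschitz_linear_continuous f _ c0) => x.
have xle i : `|x 0 i| <= `|x|.
  rewrite [leRHS]/Num.norm/= mx_normE -[leLHS]nngE num_le.
  exact: (le_bigmax _ (fun ij : 'I_1 * 'I_n => `|x ij.1 ij.2|%:nng) (0, i)).
rewrite {1}[x]row_sum_delta linear_sum (le_trans (ler_norm_sum _ _ _))//.
rewrite mulrDl mul1r mulr_suml.
rewrite (@le_trans _ _ (\sum_(i < n) `|f (delta_mx 0 i)| * `|x|))//.
  by apply: ler_sum => i _; rewrite linearZ/= normrZ mulrC ler_wpM2l.
by rewrite lerDr.
Qed.

(** With explicit epsilons, the little-o estimate can later be carried from complex to real
    scalars. *)
Lemma diff_near_le {V W} (f : V -> W) (x : V) (e : K) :
  differentiable f x -> 0 < e ->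
  \forall y \near x, `|f y - f x - 'd f x (y - x)| <= e * `|y - x|.
Proof.
move=> /diff_locally /eqaddoP fx e0; rewrite (near_shift 0).
near=> h; rewrite /= subr0 addrK.
have : `|(f \o shift x - (cst (f x) + 'd f x)) h| <= e * `|h|.
  by near: h; exact: fx.
by rewrite !fctE /= opprD addrA.
Unshelve. all: by end_near. Qed.

(** Continuous linear first-order approximations are unique, so [df] has to be the differential. *)
Lemma near_le_is_diff {V W} (f : V -> W) (df : {linear V -> W}) (x : V) :
  continuous df ->
  (forall e, 0 < e ->
    \forall y \near x, `|f y - f x - df (y - x)| <= e * `|y - x|) ->
  is_diff x f df.
Proof.
move=> dfc fx.
have dfx : f \o shift x = cst (f x) + df +o_ 0 id.
  apply/eqaddoP => e /fx; rewrite (near_shift 0); apply: filterS => h.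
  by rewrite /= subr0 addrK !fctE /= opprD addrA.
have dE := diff_unique dfc dfx.
by split => //; apply/diff_locallyP; rewrite dE.
Qed.

Lemma near_eq_is_diff {V W} (f g df : V -> W) (x : V) :
  (\forall y \near x, f y = g y) -> is_diff x f df -> is_diff x g df.
Proof.
move=> fg [fx <-]; apply: near_le_is_diff; first exact: diff_continuous.
move=> e e0; near=> y; rewrite -(nbhs_singleton fg).
have <- : f y = g y by near: y.
by near: y; exact: diff_near_le.
Unshelve. all: by end_near. Qed.

End Differentials.

(** * Complex row vectors as pairs of real ones *)

Local Notation complex_rV R n := ('rV[R[i]]_n : normedModType R[i]).

Section RealParts.
Context {R : realType} {n : nat}.

Definition cplx_mx (a b : 'rV[R]_n) : 'rV[R[i]]_n := \row_j (a 0 j +i* b 0 j).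

Lemma cplx_mx_Re_Im (z : 'rV[R[i]]_n) : cplx_mx (Re_mx z) (Im_mx z) = z.
Proof. by apply/rowP => j; rewrite !mxE; case: (z 0 j). Qed.

Lemma Re_cplx_mx a b : Re_mx (cplx_mx a b) = a.
Proof. by apply/rowP => j; rewrite !mxE. Qed.

Lemma Im_cplx_mx a b : Im_mx (cplx_mx a b) = b.
Proof. by apply/rowP => j; rewrite !mxE. Qed.

Lemma cplx_mxD a b c d :
  cplx_mx (a + c) (b + d) = cplx_mx a b + cplx_mx c d.
Proof. by apply/rowP => j; rewrite !mxE. Qed.

Lemma cplx_mxB a b c d :
  cplx_mx (a - c) (b - d) = cplx_mx a b - cplx_mx c d.
Proof. by apply/rowP => j; rewrite !mxE. Qed.

Lemma cplx_mxZ (t : R) a b : cplx_mx (t *: a) (t *: b) = t%:C *: cplx_mx a b.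
Proof. by apply/rowP => j; rewrite !mxE /=; simpc. Qed.

Lemma cplx_mx_Ci a b : 'i%C *: cplx_mx a b = cplx_mx (- b) a.
Proof. by apply/rowP => j; rewrite !mxE /=; simpc. Qed.

(** Row norms are maxima of entry norms, so the triangle inequality in each entry suffices. *)
Lemma ler_norm_cplx_mx a b : `|cplx_mx a b| <= (`|a| + `|b|)%:C.
Proof.
have r0 : 0 <= (`|a| + `|b|)%:C by rewrite ler0c addr_ge0.
rewrite [leLHS]/Num.norm/= mx_normE -[leRHS]/((NngNum r0)%:num) num_le.
have le_row (x : 'rV[R]_n) i j : `|x i j| <= `|x|.
  rewrite [leRHS]/Num.norm/= mx_normE -[leLHS]nngE num_le.
  exact: (le_bigmax _ (fun ij : 'I_1 * 'I_n => `|x ij.1 ij.2|%:nng) (i, j)).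
apply/bigmax_leP; split=> [|[i j] _]; rewrite -num_le//=.
rewrite mxE [X in `|X|]complexE (le_trans (ler_normD _ _))// normrM
  !normc_def/= !expr0n/= !add0r addr0.
by rewrite expr1n sqrtr1 mul1r !addr0 -rmorphD lecR !sqrtr_sqr lerD.
Qed.

Lemma cplx_mx_continuous :
  continuous (fun ab : 'rV[R]_n * 'rV[R]_n =>
    cplx_mx ab.1 ab.2 : complex_rV R n).
Proof.
move=> [a b] A /(@nbhs_ballP _ (complex_rV R n))[e].
(* In the order of [R[i]], [0 < e] forces [e] to be real, which provides a real radius. *)
rewrite /= ltcE/= => /andP[/eqP eI e0] eA.
have {}eI : e = (complex.Re e)%:C by rewrite [LHS]complexE eI mulr0 addr0.
apply/nbhs_ballP; exists (complex.Re e / 2); first by rewrite /= divr_gt0.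
move=> [c d] [/=]; rewrite -!ball_normE/= => ac bd; apply: eA.
rewrite -ball_normE/= -cplx_mxB (le_lt_trans (ler_norm_cplx_mx _ _))//.
by rewrite eI ltcR [ltRHS]splitr ltrD.
Qed.

End RealParts.

(** * Real differentiability of real and imaginary parts of holomorphic functions *)

(* [rho] is intended to be the real or the imaginary part. *)
Section RealPartOfHolomorphic.
Context {R : realType} {n : nat}.
Variable rho : R[i] -> R.
Hypothesis rhoD : {morph rho : x y / x + y}.
Hypothesis rhoZ : forall (t : R) x, rho (t%:C * x) = t * rho x.
Hypothesis rho_le : forall x, `|rho x|%:C <= `|x|.

(** Applying the norm-decreasing real-linear [rho] to the complex first-order estimate of [G] yields
    a real estimate, since [rho] commutes with differences. *)
Lemma is_diff_real_part (G : 'rV[R[i]]_n -> R[i]^o) (p : 'rV[R[i]]_n) :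
  differentiable G (p : complex_rV R n) ->
  is_diff (Re_mx p, Im_mx p)
    (fun ab => rho (G (cplx_mx ab.1 ab.2)) : R^o)
    (fun ab => rho ('d G (p : complex_rV R n) (cplx_mx ab.1 ab.2)) : R^o).
Proof.
move: (Re_mx p) (Im_mx p) (esym (cplx_mx_Re_Im p)) => a b -> dG.
 set df := (X in is_diff _ _ X).
have rhoN x : rho (- x) = - rho x.
  by rewrite -mulN1r -[-1]/(- (1%:C)) -rmorphN rhoZ mulN1r.
have df_lin : linear (df : 'rV[R]_n * 'rV[R]_n -> R^o).
  move=> t [u v] [u' v']; rewrite /df/= cplx_mxD cplx_mxZ.
  by rewrite linearD rhoD linearZZ rhoZ.
pose L : {linear ('rV[R]_n * 'rV[R]_n)%type -> R^o} :=
  HB.pack (df : 'rV[R]_n * 'rV[R]_n -> R^o)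
    (GRing.isLinear.Build _ _ _ _ _ df_lin).
have cplx_le (ab : 'rV[R]_n * 'rV[R]_n) :
    `|cplx_mx ab.1 ab.2| <= (2 * `|ab|)%:C.
  rewrite (le_trans (ler_norm_cplx_mx _ _))// lecR.
  by rewrite mulr_natl mulr2n lerD// /Num.norm/= ?le_max lexx ?orbT.
have rho_le_trans (x : R[i]) (c : R) : `|x| <= c%:C -> `|rho x| <= c.
  by move=> xc; rewrite -lecR (le_trans (rho_le _)).
apply: (near_le_is_diff _ L).
  have [c c0 dGc] := linear_lipschitz (diff_continuous dG).
  move: c0 dGc; rewrite ltcE/= => /andP[/eqP cI c0] dGc.
  have {}cI : c = (complex.Re c)%:C by rewrite [LHS]complexE cI mulr0 addr0.
  apply: (@lipschitz_linear_continuous _ _ _ L (complex.Re c * 2)).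
    by rewrite mulr_gt0.
  move=> ab; apply: rho_le_trans; apply: le_trans (dGc _) _.
  have -> : (complex.Re c * 2 * `|ab|)%:C = c * (2 * `|ab|)%:C.
    by rewrite [in RHS]cI -rmorphM mulrA.
  by rewrite ler_wpM2l ?cplx_le// cI ler0c ltW.
(* The half compensates the factor 2 of [cplx_le]. *)
move=> e e0; have e20 : 0 < (e / 2)%:C by rewrite ltcR divr_gt0.
have := cplx_mx_continuous (a, b) _ (diff_near_le _ _ _ dG e20).
rewrite nbhs_filterE/= => H.
have : \forall cd \near (a, b), `|G (cplx_mx cd.1 cd.2) - G (cplx_mx a b)
    - 'd G (cplx_mx a b : complex_rV R n) (cplx_mx cd.1 cd.2 - cplx_mx a b)|
    <= (e / 2)%:C * `|cplx_mx cd.1 cd.2 - cplx_mx a b| by [].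
apply: filterS => -[c d] cd.
rewrite [X in `|_ - X|]/(df _) /df /=.
have -> (x y z : R[i]) : rho x - rho y - rho z = rho (x - y - z).
  by rewrite !rhoD !rhoN.
rewrite cplx_mxB; apply: rho_le_trans.
apply: le_trans cd _.
rewrite -cplx_mxB (@le_trans _ _ ((e / 2)%:C * (2 * `|(c - a, d - b)|)%:C))//.
  by rewrite ler_wpM2l ?(ltW e20)// (cplx_le (c - a, d - b)).
by rewrite -rmorphM lecR mulrA divfK.
Qed.

(** Chain rule: [F] is factored through the pair of its real and imaginary parts, where the previous
    lemma applies. *)
Lemma is_diff_real_part_comp {k : nat} (G : 'rV[R[i]]_n -> R[i]^o)
    (F : 'rV[R]_k -> 'rV[R[i]]_n) (y : 'rV[R]_k) :
  differentiable (@Re_mx R n \o F) y -> differentiable (@Im_mx R n \o F) y ->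
  differentiable G (F y : complex_rV R n) ->
  is_diff y (fun z => rho (G (F z)) : R^o)
    (fun v => rho ('d G (F y : complex_rV R n) (real_diff F y v)) : R^o).
Proof.
move=> dR dI /is_diff_real_part dG.
have dRI := is_diff_pair (differentiableP dR) (differentiableP dI).
have := is_diff_comp dRI dG.
by congr (is_diff _ _ _); apply/funext => z /=; rewrite cplx_mx_Re_Im.
Qed.

End RealPartOfHolomorphic.

(** * Derivatives of curves and functions with zero differential *)

Section Derivatives.
Context {R : realType}.
Implicit Types V W : normedModType R.

Lemma is_derive1_is_diff {V} (f : R -> V) (t : R) (X : V) :
  is_derive t 1 f X <-> is_diff t f ( *:%R^~ X ).
Proof.
split=> [[/derivable1_diffP ft fX]|[ft fX]].
  split=> //; apply/funext => s; rewrite -[in LHS](mulr1 s) -[s * 1]/(s *: 1).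
  by rewrite linearZ/= -deriveE// fX.
by split; [exact/derivable1_diffP|rewrite deriveE// fX scale1r].
Qed.

Lemma near_le_is_derive1 {V} (f : R -> V) (t : R) (X : V) :
  (forall e, 0 < e ->
    \forall s \near t, `|f s - f t - (s - t) *: X| <= e * `|s - t|) ->
  is_derive t 1 f X.
Proof.
move=> ft; apply/is_derive1_is_diff.
have lin : linear ( *:%R^~ X : R -> V).
  by move=> a s s'; rewrite scalerDl scalerA.
pose L : {linear R -> V} :=
  HB.pack ( *:%R^~ X : R -> V) (GRing.isLinear.Build _ _ _ _ _ lin).
by apply: (near_le_is_diff f L) => //; exact: scalel_continuous.
Qed.

Lemma is_derive1_diff_comp {V W} (h : R -> V) (Phi : V -> W) (t : R) (X : V) :
  is_derive t 1 h X -> differentiable Phi (h t) ->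
  is_derive t 1 (Phi \o h) ('d Phi (h t) X).
Proof.
move=> /is_derive1_is_diff ht /differentiableP Pt; apply/is_derive1_is_diff.
have := is_diff_comp ht Pt; congr (is_diff _ _ _).
by apply/funext => s /=; rewrite linearZ.
Qed.

(* Psi is the identity to first order at h t: first h s - h t = O(s - t),
   and the error is then o(s - t). *)
Lemma is_derive1_lift {V} (h : R -> V) (Psi : V -> V) (t : R) (X : V) :
  {for t, continuous h} -> is_diff (h t) Psi id ->
  is_derive t 1 (Psi \o h) X -> is_derive t 1 h X.
Proof.
move=> hc [dPsi PsiE] dX; apply: near_le_is_derive1 => e e0.
have le_h d : 0 < d -> \forall s \near t,
    `|Psi (h s) - Psi (h t) - (h s - h t)| <= d * `|h s - h t|.
  by move=> d0; have := diff_near_le _ _ _ dPsi d0; rewrite PsiE => /hc.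
have le_Psi d : 0 < d -> \forall s \near t,
    `|Psi (h s) - Psi (h t) - (s - t) *: X| <= d * `|s - t|.
  have [/derivable1_diffP dPh _] := dX => d0.
  have := diff_near_le _ _ _ dPh d0; apply: filterS => s /=.
  by have /is_derive1_is_diff[_ ->] := dX.
(* By [Ps1], [c] will be a Lipschitz constant of [Psi \o h] at [t]. As [H] is then at most
   [2 * c * |s - t|], the factor [e / (4 * c)] contributes [e / 2], and [Ps2] the other half. *)
pose c := `|X| + 1; have c0 : 0 < c by rewrite ltr_wpDl.
have e'0 : 0 < e / (4 * c) by rewrite divr_gt0// mulr_gt0.
near=> s.
have hs1 : `|Psi (h s) - Psi (h t) - (h s - h t)| <= 2^-1 * `|h s - h t|.
  by near: s; exact: le_h.
have hs2 : `|Psi (h s) - Psi (h t) - (h s - h t)| <= e / (4 * c) * `|h s - h t|.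
  by near: s; exact: le_h.
have Ps1 : `|Psi (h s) - Psi (h t) - (s - t) *: X| <= 1 * `|s - t|.
  by near: s; exact: le_Psi.
have Ps2 : `|Psi (h s) - Psi (h t) - (s - t) *: X| <= e / 2 * `|s - t|.
  by near: s; apply: le_Psi; rewrite divr_gt0.
set D := Psi (h s) - Psi (h t) in hs1 hs2 Ps1 Ps2.
set H := h s - h t in hs1 hs2 *.
have D_le : `|D| <= c * `|s - t|.
  rewrite -(subrK ((s - t) *: X) D) (le_trans (ler_normD _ _))// normrZ.
  by rewrite /c mulrDl addrC [`|X| * _]mulrC lerD.
(* By [hs1], half of the norm of [H] can be absorbed into the left-hand side. *)
have H_le : `|H| <= 2 * (c * `|s - t|).
  have : `|H| <= `|D| + 2^-1 * `|H|.
    rewrite -[X in `|X| <= _](subKr D) (le_trans (ler_normB _ _))// lerD2l.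
    exact: hs1.
  by move: D_le; lra.
rewrite -(subrK D H) -addrA (le_trans (ler_normD _ _))//.
rewrite distrC (@le_trans _ _
  (e / (4 * c) * (2 * (c * `|s - t|)) + e / 2 * `|s - t|))//.
  by rewrite lerD// (le_trans hs2)// ler_wpM2l// ltW.
rewrite le_eqVlt; apply/orP; left; apply/eqP; field.
by rewrite gt_eqF.
Unshelve. all: by end_near. Qed.

(** Balls are convex, so the mean value theorem applies along the segment from [x] to [z]. *)
Lemma zero_diff_constant {V : normedModType R} (f : V -> R^o) (x : V) (r : R) :
  (forall z, ball x r z -> is_diff z f 0) ->
  forall z, ball x r z -> f z = f x.
Proof.
move=> df z xz; pose g (s : R) : R^o := f (s *: (z - x) + x).
have xgs (s : R) : 0 <= s <= 1 -> ball x r (s *: (z - x) + x).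
  move=> /andP[s0 s1]; move: xz; rewrite -!ball_normE/= => xz.
  rewrite opprD addrCA subrr addr0 normrN normrZ ger0_norm//.
  by rewrite (le_lt_trans _ xz)// distrC ler_piMl.
have dg (s : R) : 0 <= s <= 1 -> is_derive s 1 g 0.
  move=> /xgs/df[dfs dfE].
  have hs : is_derive s 1 (fun s : R => s *: (z - x) + x) (z - x).
    apply/is_derive1_is_diff.
    have := is_diffD (is_diff_scalel s (z - x)) (is_diff_cst x s).
    by rewrite addr0.
  by have := is_derive1_diff_comp _ _ _ _ hs dfs; rewrite dfE.
have [|s||c _] := @MVT_segment R g (fun=> 0) 0 1.
- by [].
- by rewrite in_itv/= => /andP[s0 s1]; apply: dg; rewrite !ltW.
- apply/continuous_in_subspaceT => s /[!inE]/=; rewrite in_itv/= => /dg[+ _].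
  by move=> /derivable1_diffP; exact: differentiable_continuous.
rewrite mul0r => /eqP; rewrite subr_eq0 /g scale1r subrK scale0r add0r => /eqP.
by [].
Qed.

End Derivatives.

(** * The properties required of [rho], for the real and imaginary parts *)

Section ReIm.
Context {R : realType}.

Lemma ReD : {morph @complex.Re R : x y / x + y}.
Proof. by case=> a b [c d]. Qed.

Lemma ImD : {morph @complex.Im R : x y / x + y}.
Proof. by case=> a b [c d]. Qed.

Lemma ReZ (t : R) x : complex.Re (t%:C * x) = t * complex.Re x.
Proof. by case: x => a b /=; rewrite mul0r subr0. Qed.

Lemma ImZ (t : R) x : complex.Im (t%:C * x) = t * complex.Im x.
Proof. by case: x => a b /=; rewrite mul0r addr0. Qed.

Lemma ler_Re (x : R[i]) : `|complex.Re x|%:C <= `|x|.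
Proof. by rewrite normc_def lecR -sqrtr_sqr ler_wsqrtr// lerDl sqr_ge0. Qed.

Lemma ler_Im (x : R[i]) : `|complex.Im x|%:C <= `|x|.
Proof. by rewrite normc_def lecR -sqrtr_sqr ler_wsqrtr// lerDr sqr_ge0. Qed.

End ReIm.

(** * Real-linear maps into complex row vectors *)

Section RealLinearMaps.
Context {R : realType}.

Lemma cplx_mx_linearB {k n : nat} (A B : {linear 'rV[R]_k -> 'rV[R]_n}) a b :
  cplx_mx (A (a - b)) (B (a - b)) = cplx_mx (A a) (B a) - cplx_mx (A b) (B b).
Proof. by rewrite !linearB cplx_mxB. Qed.

(** Injectivity says that the matrix [[A B]] has full row rank; [P] and [Q] are the upper and lower
    halves of a right inverse of it. *)
Lemma cplx_mx_left_inverse {k n : nat} (A B : {linear 'rV[R]_k -> 'rV[R]_n}) :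
  injective (fun v => cplx_mx (A v) (B v)) ->
  exists P Q : 'M[R]_(n, k), forall v, A v *m P + B v *m Q = v.
Proof.
move=> AB_inj; have : row_free (row_mx (lin1_mx A) (lin1_mx B)).
  apply: inj_row_free => v; rewrite mul_mx_row !mul_rV_lin1.
  rewrite -[0]row_mx0 => /eq_row_mx[Av Bv]; apply: AB_inj.
  by rewrite Av Bv !linear0.
move=> /row_freeP[C CE]; exists (usubmx C), (dsubmx C) => v.
rewrite -!mul_rV_lin1 -!mulmxA -mulmxDr -mul_row_col vsubmxK CE mulmx1.
by [].
Qed.

(** The map from (a, b) to [L a + i L b] is an injective real-linear map between spaces of real
    dimension 2n, hence onto. *)
Lemma cplx_mx_decomposition {n : nat} (A B : {linear 'rV[R]_n -> 'rV[R]_n}) :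
  let L v := cplx_mx (A v) (B v) in
  (forall a b, L a + 'i%C *: L b = 0 -> a = 0 /\ b = 0) ->
  forall w, exists a b, w = L a + 'i%C *: L b.
Proof.
move=> L L_free w.
(* [D] is the matrix of this map, with real and imaginary parts of the value side by side. *)
pose D := block_mx (lin1_mx A) (lin1_mx B) (- lin1_mx B) (lin1_mx A).
have DE a b : row_mx a b *m D = row_mx (A a - B b) (B a + A b).
  by rewrite mul_row_block !mulmxN !mul_rV_lin1.
have LE a b : L a + 'i%C *: L b = cplx_mx (A a - B b) (B a + A b).
  by rewrite /L cplx_mx_Ci -cplx_mxD.
have Du : D \in unitmx.
  rewrite -row_free_unit; apply: inj_row_free => v.
  rewrite -[v]hsubmxK DE -[RHS]row_mx0 => /eq_row_mx[ReE ImE].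
  have [|-> ->] := L_free (lsubmx v) (rsubmx v); last by rewrite row_mx0.
  by rewrite LE ReE ImE; apply/rowP => j; rewrite !mxE.
have := mulmxKV Du (row_mx (Re_mx w) (Im_mx w)).
set v := _ *m invmx D; rewrite -[v]hsubmxK DE => /eq_row_mx[ReE ImE].
by exists (lsubmx v), (rsubmx v); rewrite LE ReE ImE cplx_mx_Re_Im.
Qed.

End RealLinearMaps.

(** * Neighbourhoods in charts *)

Section Charts.
Context {K : numFieldType} {n : nat} {T : topologicalType}.
Variable c : chart K n T.

Lemma near_dom {x : T} : dom c x -> \forall y \near x, dom c y.
Proof. by move=> cx; apply: open_nbhs_nbhs; split => //; exact: open_dom. Qed.

Lemma near_img {x : T} : dom c x -> \forall z \near c x, img c z.
Proof.
by move=> cx; apply: open_nbhs_nbhs; split; [exact: open_img|exact: imageP].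
Qed.

Lemma near_param {x : T} {P : set T} :
  dom c x -> (\forall y \near x, P y) -> \forall z \near c x, P (param c z).
Proof.
move=> cx Px; have /(param_continuous (c := c)) := imageP c cx.
by apply; rewrite /= coordK.
Qed.

End Charts.

(** * Functions and curves on an embedded submanifold *)

Section Submanifolds.
Context {R : realType} {n k : nat} {M : topologicalType}.
Context {CM : complex_manifold R n M} {N : set M} {SN : smooth_manifold R k N}.

Lemma set_val_continuous : continuous (set_val : N -> M).
Proof. exact: initial_continuous. Qed.

(** Open sets of [N] are the traces of open sets of [M]. *)
Lemma continuous_into_subtype (g : R -> N) (t : R) :
  {for t, continuous (fun s => set_val (g s))} -> {for t, continuous g}.
Proof.
move=> gc A [_ [[B oB <-] Bgt] BA]; apply: (@filterS _ _ _ _ _ BA).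
by apply: gc; exact: open_nbhs_nbhs.
Qed.

Hypothesis embedded : embedded_submanifold CM SN.

Lemma differentiable_inclusion_in (x : N) (y : M) (z : 'rV[R]_k) :
  img (chart_at SN x) z ->
  dom (chart_at CM y) (set_val (param (chart_at SN x) z)) ->
  differentiable (@Re_mx R n \o inclusion_in CM SN x y) z /\
  differentiable (@Im_mx R n \o inclusion_in CM SN x y) z.
Proof.
move=> xz yz; have [/(_ 1%N)[/= dR _] /(_ 1%N)[/= dI _]] := embedded.1 x y.
by split; [apply: dR|apply: dI].
Qed.

Lemma near_dom_chart (x : N) :
  \forall y \near x, dom (chart_at CM (set_val x)) (set_val y).
Proof.
by apply: set_val_continuous; exact/near_dom/dom_chart_at.
Qed.

Section Restriction.
Variable f : M -> R[i].
Hypothesis f_regular : regular_function CM f.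
Variable rho : R[i] -> R.
Hypothesis rhoD : {morph rho : x y / x + y}.
Hypothesis rhoZ : forall (t : R) x, rho (t%:C * x) = t * rho x.
Hypothesis rho_le : forall x, `|rho x|%:C <= `|x|.

(** Chain rule for [f] in the chart of [M] composed with the inclusion in charts; with [rho] the
    real or imaginary part it computes du or dv on [N]. *)
Lemma is_diff_restriction (x : N) :
  is_diff (chart_at SN x x)
    (fun z => rho (f (set_val (param (chart_at SN x) z))) : R^o)
    (fun v => rho (differential CM f (set_val x) (dincl CM SN x v)) : R^o).
Proof.
have xx := dom_chart_at SN x; have xM := dom_chart_at CM (set_val x).
have F0 : inclusion_in CM SN x (set_val x) (chart_at SN x x) =
    chart_at CM (set_val x) (set_val x).
  by rewrite /inclusion_in coordK.
have [||dR dI] := @differentiable_inclusion_in x (set_val x) (chart_at SN x x).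
- exact: imageP.
- by rewrite coordK.
have := is_diff_real_part_comp rho rhoD rhoZ rho_le
  (f \o param (chart_at CM (set_val x))) _ _ dR dI.
rewrite F0 => /(_ (f_regular _ _ (imageP _ xM))).
(* The chart of [M] and its inverse cancel only where the inclusion stays in the domain of that
   chart, that is, near [x]. *)
apply: near_eq_is_diff.
have := near_param _ xx (near_dom_chart x); apply: filterS => z zM.
by rewrite /inclusion_in/= coordK.
Qed.

Lemma locally_constant_restriction :
  locally_constant (fun x : N => rho (f (set_val x))) <->
  forall (x : N) v, rho (differential CM f (set_val x) (dincl CM SN x v)) = 0.
Proof.
split=> [lc x v|d0 x].
  have [_ dE] := is_diff_restriction x.
  have xx := dom_chart_at SN x.
  have [_] : is_diff (chart_at SN x x)
      (fun z => rho (f (set_val (param (chart_at SN x) z))) : R^o) 0.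
    apply: near_eq_is_diff (is_diff_cst (rho (f (set_val x)) : R^o) _).
    by have := near_param _ xx (lc x); apply: filterS => z ->.
  by rewrite dE => /(congr1 (fun h => h v)).
pose V p z : R^o := rho (f (set_val (param (chart_at SN p) z))).
have dV0 p : is_diff (chart_at SN p p) (V p) 0.
  have := is_diff_restriction p; congr (is_diff _ _ _).
  by apply/funext => v; exact: d0.
(* [dV0] concerns only the base point of each chart; the transition map [tau] carries it to every
   point of the single chart at [x], where [zero_diff_constant] can be used on a ball. *)
have dV z : img (chart_at SN x) z -> is_diff z (V x) 0.
  move=> [p xp <-]; have pp := dom_chart_at SN p.
  pose tau := chart_at SN p \o param (chart_at SN x).
  have dtau : differentiable tau (chart_at SN x p).
    have [+ _] := transition_regular SN x p 1%N; apply.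
    split; first exact: imageP.
    by rewrite /= coordK.
  have tauE : tau (chart_at SN x p) = chart_at SN p p by rewrite /tau/= coordK.
  have := dV0 p; rewrite -tauE => /(is_diff_comp (differentiableP dtau)).
  rewrite (_ : 0 \o _ = 0); last exact/funext.
  apply: near_eq_is_diff.
  have := near_param _ xp (near_dom _ pp); apply: filterS => w pw.
  by rewrite /V/= coordK.
have xx := dom_chart_at SN x.
have /nbhs_ballP[r /= r0 rV] := near_img _ xx.
have Vcst := zero_diff_constant (V x) _ r (fun z xz => dV z (rV z xz)).
have ball_r : \forall y \near x, ball (chart_at SN x x) r (chart_at SN x y).
  exact: (Defs.coord_continuous xx (nbhsx_ballx _ _ r0)).
apply: filterS2 (near_dom _ xx) ball_r => y xy /Vcst.
by rewrite /V !coordK.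
Qed.

End Restriction.

(** From [N] to [M] this is the chain rule. The converse recovers the derivative in [N] through a
    left inverse of [dincl] and [is_derive1_lift]. *)
Lemma is_derive1_dincl (g : R -> N) (t : R) (X : 'rV[R]_k) :
  {for t, continuous g} ->
  (is_derive t 1 (@Re_mx R n \o chart_at CM (set_val (g t)) \o set_val \o g)
     (Re_mx (dincl CM SN (g t) X)) /\
   is_derive t 1 (@Im_mx R n \o chart_at CM (set_val (g t)) \o set_val \o g)
     (Im_mx (dincl CM SN (g t) X))) <->
  is_derive t 1 (chart_at SN (g t) \o g) X.
Proof.
move=> gc; set x := g t; set c := chart_at SN x; set h := c \o g.
have xx : dom c x := dom_chart_at SN x.
pose F := inclusion_in CM SN x (set_val x).
have [||dR dI] := @differentiable_inclusion_in x (set_val x) (c x).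
- exact: imageP.
- by rewrite coordK//; exact: dom_chart_at.
pose A := 'd (@Re_mx R n \o F) (c x); pose B := 'd (@Im_mx R n \o F) (c x).
have gE (rho : 'rV[R[i]]_n -> 'rV[R]_n) :
    \forall s \near t, (rho \o F \o h) s =
      (rho \o chart_at CM (set_val x) \o set_val \o g) s.
  have gx : \forall s \near t, dom c (g s) := gc _ (near_dom _ xx).
  apply: filterS gx => s xs.
  by rewrite /F/h/inclusion_in/= coordK.
have ReE : Re_mx (dincl CM SN x X) = A X by exact: Re_cplx_mx.
have ImE : Im_mx (dincl CM SN x X) = B X by exact: Im_cplx_mx.
rewrite ReE ImE; split=> [[dRg dIg]|dh]; last first.
  split; apply: near_eq_is_derive (gE _) _.
    exact: is_derive1_diff_comp dh dR.
  exact: is_derive1_diff_comp dh dI.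
have [P [Q PQ]] := cplx_mx_left_inverse A B (embedded.2 x).
have mul_diff (C : 'M[R]_(n, k)) (y : 'rV[R]_n) :
    is_diff y (mulmxr C) (mulmxr C).
  pose L : {linear 'rV[R]_n -> 'rV[R]_k} := mulmxr C.
  have cL : continuous L := rV_linear_continuous L.
  by split; [exact: (linear_differentiable y cL)|exact: (diff_lin y cL)].
(* [P] and [Q] invert the differential of [F] at [c x], so [Psi] has the identity as differential
   there, while [Psi \o h] depends only on the curve seen in [M]. *)
pose Psi z := Re_mx (F z) *m P + Im_mx (F z) *m Q.
have dPsi : is_diff (h t) Psi id.
  have := is_diffD (is_diff_comp (differentiableP dR) (mul_diff P _))
    (is_diff_comp (differentiableP dI) (mul_diff Q _)).
  by congr (is_diff _ _ _); apply/funext => v; exact: PQ.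
have hc : {for t, continuous h}.
  by apply: continuous_comp => //; exact: Defs.coord_continuous.
apply: (is_derive1_lift h Psi t X hc dPsi).
have dmul (C : 'M[R]_(n, k)) (H : R -> 'rV[R]_n) Y :
    is_derive t 1 H Y -> is_derive t 1 (mulmxr C \o H) (Y *m C).
  have [dC dCE] := mul_diff C (H t) => /is_derive1_diff_comp /(_ dC).
  by rewrite dCE.
have := is_deriveD (dmul P _ _ dRg) (dmul Q _ _ dIg).
rewrite PQ; apply: near_eq_is_derive.
apply: filterS2 (gE (@Re_mx R n)) (gE (@Im_mx R n)) => s /= Rs Is.
by rewrite fctE/= /Psi Rs Is.
Qed.

End Submanifolds.

(** * Tangent spaces of [N] as real forms, and Hamiltonian fields, with [N] of dimension n *)

Section RealSymplecticForms.
Context {R : realType} {n : nat} {M : topologicalType}.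
Context {CM : complex_manifold R n M} {N : set M} {SN : smooth_manifold R n N}.
Context {Omega : M -> 'rV[R[i]]_n -> 'rV[R[i]]_n -> R[i]}.
Hypothesis Omega_symplectic : symplectic CM Omega.
Hypothesis N_real : real_symplectic_form CM SN Omega.

Lemma dinclB (x : N) (a b : 'rV[R]_n) :
  dincl CM SN x (a - b) = dincl CM SN x a - dincl CM SN x b.
Proof.
pose F := inclusion_in CM SN x (set_val x).
exact: (cplx_mx_linearB ('d (@Re_mx R n \o F) _) ('d (@Im_mx R n \o F) _)).
Qed.

Lemma dincl0 (x : N) : dincl CM SN x 0 = 0.
Proof. by rewrite -(subrr 0) dinclB subrr. Qed.

(** Total reality gives freeness over the complex numbers, and the dimension count of
    [cplx_mx_decomposition] turns it into spanning. *)
Lemma complexified_tangent_space (x : N) (w : 'rV[R[i]]_n) :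
  exists a b, w = dincl CM SN x a + 'i%C *: dincl CM SN x b.
Proof.
have [embedded N_totally_real _ _] := N_real.
have dincl_eq0 c : dincl CM SN x c = 0 -> c = 0.
  by rewrite -(dincl0 x) => /(embedded.2 x).
apply: (cplx_mx_decomposition ('d (@Re_mx R n \o _) _) ('d (@Im_mx R n \o _) _)).
move=> a b L_ab.
have ab0 : dincl CM SN x a + 'i%C *: dincl CM SN x b = 0 := L_ab.
have a0 : a = 0.
  apply: dincl_eq0; have : [set 0] (dincl CM SN x a).
    rewrite -(N_totally_real x); split; first by exists a.
    (* The relation reads [dincl a = i * dincl (- b)], a vector of both T and iT; the form [0 - b]
       suits [dinclB]. *)
    exists (dincl CM SN x (0 - b)); first by exists (0 - b).
    by rewrite dinclB dincl0 sub0r scalerN;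
      apply/eqP; rewrite eq_sym -addr_eq0 ab0.
  by [].
split=> //; apply: dincl_eq0; move: ab0; rewrite a0 dincl0 add0r => /eqP.
by rewrite scaler_eq0 eq_complex/= oner_eq0 andbF => /eqP.
Qed.

Lemma Im_Omega_dincl (x : N) (a b : 'rV[R]_n) :
  complex.Im (Omega (set_val x) (dincl CM SN x a) (dincl CM SN x b)) = 0.
Proof. by have [_ _ _ +] := N_real; apply; [exists a|exists b]. Qed.

(** [Omega] is real on T, so its real part determines it there; a vector of T orthogonal to T is
    then orthogonal to T + iT by complex linearity. *)
Lemma omegaR_hat_nondegenerate (x : N) (a : 'rV[R]_n) :
  (forall v, omegaR_hat CM SN Omega x a v = 0) -> a = 0.
Proof.
move=> a0; have [embedded _ _ _] := N_real; apply: (embedded.2 x).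
rewrite dincl0.
apply: (symplectic_nondegenerate Omega_symplectic (x := set_val x)).
have O0 v : Omega (set_val x) (dincl CM SN x a) (dincl CM SN x v) = 0.
  by rewrite [LHS]complexE Im_Omega_dincl mulr0 addr0 [complex.Re _]a0.
move=> w; have [b [c ->]] := complexified_tangent_space x w.
have Olin := symplectic_linearr Omega_symplectic (set_val x) (dincl CM SN x a).
by rewrite addrC Olin !O0 mulr0 addr0.
Qed.

Section HamiltonianField.
Context {f : M -> R[i]} {Xf : M -> 'rV[R[i]]_n}.
Hypothesis f_regular : regular_function CM f.
Hypothesis Xf_hamiltonian : is_hamiltonian_field CM Omega f Xf.

Lemma invariant_under_flowP :
  invariant_under_flow CM SN Xf <->
  locally_constant (fun x : N => complex.Im (f (set_val x))).
Proof.
have [embedded _ _ _] := N_real.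
apply: iff_trans (iff_sym (locally_constant_restriction embedded _ f_regular _
  ImD ImZ ler_Im)).
split=> [inv x v|d0 x].
  by rewrite -Xf_hamiltonian; have [a _ <-] := inv x; exact: Im_Omega_dincl.
have [a [b XfE]] := complexified_tangent_space x (Xf (set_val x)).
suff b0 : b = 0 by exists a => //; rewrite XfE b0 dincl0 scaler0 addr0.
apply: (omegaR_hat_nondegenerate x) => v.
(* For w in T, [Omega] of (a + ib, w) has imaginary part Re [Omega] of (b, w), because both [Omega]
   of (a, w) and [Omega] of (b, w) are real. *)
have := d0 x v; rewrite -Xf_hamiltonian XfE addrC.
rewrite (symplectic_linearl Omega_symplectic (set_val x)) ImD Im_Omega_dincl addr0.
by rewrite mulrC ImiRe.
Qed.

Lemma is_hamiltonian_field_restriction (Xu : N -> 'rV[R]_n) :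
  (forall x, dincl CM SN x (Xu x) = Xf (set_val x)) ->
  is_hamiltonian_field SN (omegaR_hat CM SN Omega)
    (fun x : N => complex.Re (f (set_val x))) Xu.
Proof.
have [embedded _ _ _] := N_real => XuE x Y.
rewrite /omegaR_hat XuE Xf_hamiltonian.
by have [_ dE] := is_diff_restriction embedded f f_regular _ ReD ReZ ler_Re x;
  rewrite [RHS](congr1 (fun h => h Y) dE).
Qed.

Lemma omegaR_hat_hamiltonian_unique (u : N -> R) (X Y : N -> 'rV[R]_n) :
  is_hamiltonian_field SN (omegaR_hat CM SN Omega) u X ->
  is_hamiltonian_field SN (omegaR_hat CM SN Omega) u Y ->
  forall x, X x = Y x.
Proof.
move=> hX hY x; apply/eqP; rewrite -subr_eq0; apply/eqP.
apply: (omegaR_hat_nondegenerate x) => v.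
have Olin := symplectic_linearl Omega_symplectic (set_val x) (dincl CM SN x v).
have := etrans (hX x v) (esym (hY x v)); rewrite /omegaR_hat => XY.
(* Linearity has the form [k *: u + v], so the difference is read with [k = -1], a real scalar that
   passes through the real part. *)
rewrite dinclB addrC -scaleN1r Olin ReD -[-1]/(- 1%:C) -rmorphN ReZ XY.
by rewrite mulN1r addNr.
Qed.

End HamiltonianField.

End RealSymplecticForms.

Theorem theorem2p5 (R : realType) (n k : nat) (M : topologicalType)
  (CM : complex_manifold R n M)
  (Omega : M -> 'rV[R[i]]_n -> 'rV[R[i]]_n -> R[i])
  (hOmega : symplectic CM Omega)
  (N : set M) (SN : smooth_manifold R k N)
  (hN : real_symplectic_form CM SN Omega)
  (f : M -> R[i]) (hf : regular_function CM f)
  (Xf : M -> 'rV[R[i]]_n) (hXf : is_hamiltonian_field CM Omega f Xf) :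
  let u (x : N) : R := complex.Re (f (set_val x)) in
  let v (x : N) : R := complex.Im (f (set_val x)) in
  (invariant_under_flow CM SN Xf <-> locally_constant v) /\
  (invariant_under_flow CM SN Xf ->
   exists Xu : N -> 'rV[R]_k,
     [/\ is_hamiltonian_field SN (omegaR_hat CM SN Omega) u Xu,
         (forall Z : N -> 'rV[R]_k,
            is_hamiltonian_field SN (omegaR_hat CM SN Omega) u Z ->
            forall x : N, Z x = Xu x),
         (forall x : N, dincl CM SN x (Xu x) = Xf (set_val x)) &
         (forall (J : set R) (g : R -> N), open J -> is_interval J ->
            (complex_integral_curve CM Xf J (fun t => set_val (g t)) <->
             integral_curve SN Xu J g))]).
Proof.
have [embedded _ kn _] := hN.
(* Half of the real dimension 2n is n, the setting of the preceding lemmas. *)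
have {kn} kn : k = n by apply: double_inj; rewrite -mul2n.
subst k; split; first exact: (invariant_under_flowP hOmega hN hf hXf).
(* Tangency gives a preimage of [Xf] under [dincl] at each point; choice assembles them into a
   field. *)
move=> inv; have /choice[Xu XuE] (x : N) :
    exists X, dincl CM SN x X = Xf (set_val x).
  by have [X _ XE] := inv x; exists X.
have Xu_ham := is_hamiltonian_field_restriction hN hf hXf Xu XuE.
exists Xu; split=> // [Z Z_ham x|J g _ _].
  exact: omegaR_hat_hamiltonian_unique Z_ham Xu_ham x.
(* Both notions of integral curve are conditions at each time, compared there through [XuE]. *)
split=> curve t /curve.
  move=> [/continuous_into_subtype gc dRe dIm]; split => //.
  by apply/(is_derive1_dincl embedded) => //; rewrite XuE.
move=> [gc dg]; have := (is_derive1_dincl embedded _ _ _ gc).2 dg.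
rewrite XuE => -[dRe dIm]; split => //.
exact: continuous_comp gc (set_val_continuous _).
Qed.
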